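(* (Gorelik principle for net equivalences.) Let $X$ and $Y$ be two infinite-dimensional real Banach spaces, and let $X_0$ be a closed linear subspace of $X$ of finite codimension. If $X$ and $Y$ are net equivalent, then there are continuous maps $U:X\to Y$ and $V:Y\to X$ and constants $K, C, \alpha_0>0$ such that $$\forall x\in X\ \ \|VUx-x\|\le C\quad\text{and}\quad \forall y\in Y\ \ \|UVy-y\|\le C,$$ and for every $\alpha>\alpha_0$ there is a compact subset $M$ of $Y$ such that $$\frac{\alpha}{16K}B_Y\subset M+CB_Y+U(\alpha B_{X_0}).$$
   Context: All Banach spaces are real. $B_E$ denotes the closed unit ball of a normed space $E$; sums of sets are Minkowski sums. The maps $U,V$ are not assumed linear. For $0<a\le b$, an $(a,b)$-net in a metric space $(M,d)$ is a subset $\mathcal M\subset M$ such that $d(z,z')\ge a$ for all $z\ne z'$ in $\mathcal M$ and $d(x,\mathcal M)<b$ for every $x\in M$. A net is an $(a,b)$-net for some $0<a\le b$. Two metric spaces are Lipschitz equivalent if there is a bijection $f$ between them such that $f$ and $f^{-1}$ are Lipschitz. Two infinite-dimensional Banach spaces $X$ and $Y$ are net equivalent if there exist a net $\mathcal M$ in $X$ and a net $\mathcal N$ in $Y$ such that $\mathcal M$ and $\mathcal N$ (with the metrics induced by the norms) are Lipschitz equivalent. *)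

(* Defs.v *)
From HB Require Import structures.
From mathcomp Require Import all_boot all_order all_algebra.
From mathcomp Require Import all_classical all_reals all_analysis.

Set Implicit Arguments.
Unset Strict Implicit.
Unset Printing Implicit Defensive.

Import Order.TTheory GRing.Theory Num.Theory.
Import numFieldNormedType.Exports.

Local Open Scope classical_set_scope.
Local Open Scope ring_scope.

Definition finite_dimensional (R : realType) (X : lmodType R) : Prop :=
  exists (n : nat) (v : 'I_n -> X), forall x : X,
    exists c : 'I_n -> R, x = \sum_(i < n) c i *: v i.

(* The quotient X / X0 is spanned by the classes of finitely many vectors. *)
Definition finite_codimensional (R : realType) (X : lmodType R) (X0 : set X) :
    Prop :=
  exists (n : nat) (v : 'I_n -> X), forall x : X,
    exists c : 'I_n -> R, X0 (x - \sum_(i < n) c i *: v i).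

(* edist_inf M x is the extended-real infimum of the distances from x to the  *)
(* points of M, which is +oo when M is empty; so nets are nonempty.           *)
Definition ab_net (R : realType) (X : normedModType R) (a b : R) (M : set X) :
    Prop :=
  (forall z z', M z -> M z' -> z <> z' -> a <= `|z - z'|) /\
  (forall x, (edist_inf M x < b%:E)%E).

Definition net (R : realType) (X : normedModType R) (M : set X) : Prop :=
  exists a b : R, [/\ 0 < a, a <= b & ab_net a b M].

(* The metrics on M and N are those induced by the norms.  A map M -> N is    *)
(* represented by a total function, of which only the values on M matter; g   *)
(* restricted to N is the inverse of the bijection M -> N given by f.         *)
Definition lipschitz_equivalent (R : realType) (X Y : normedModType R)
    (M : set X) (N : set Y) : Prop :=
  exists (f : X -> Y) (g : Y -> X),
    [/\ set_bij M N f, {in M, cancel f g},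
        [lipschitz f x | x in M] & [lipschitz g y | y in N]].

Definition net_equivalent (R : realType) (X Y : normedModType R) : Prop :=
  exists (M : set X) (N : set Y),
    [/\ net M, net N & lipschitz_equivalent M N].

Definition unit_ball (R : realType) (E : normedModType R) : set E :=
  [set x | `|x| <= 1].
Arguments unit_ball {R} E.

Definition scale_set (R : realType) (E : lmodType R) (r : R) (A : set E) :
    set E :=
  [set r *: x | x in A].

Definition minkowski_sum (R : realType) (E : lmodType R) (A B : set E) :
    set E :=
  [set x + y | x in A & y in B].

(* Main.v *)
(**
  Precomposing the Lipschitz bijections of the nets with nearest-point maps and
  averaging over a locally finite partition of unity gives continuous U and V
  that are Lipschitz at large distances and inverse to each other up to a bounded
  error.  Let v_1, ..., v_n span a complement of X0.  For y of norm at most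
  alpha / (16 K), the map phi(a) = V (U a + y) displaces every point by a small
  fraction of alpha.  On the grid of points a = sum_i t_i v_i with integers t_i in
  [-m, m], m a small multiple of alpha, the i-th coordinate of phi(a) modulo X0 is
  therefore negative on the face t_i = -m and positive on the face t_i = m.  A
  discrete Poincare-Miranda theorem yields a grid cell on which every coordinate
  changes sign, so phi(a) lies at bounded distance from some x in X0 for a vertex
  a of this cell.  Then U x is within C of U a + y, and M can be taken to be the
  finite set of the - U a.  Since the bounded distance is absorbed in C, no exact
  fixed point theorem is required.

  The discrete theorem is a cup product computation on the torus (Z/(N+1))^n
  with its Kuhn triangulation, whose simplices are the lattice paths v, v +
  e_(s 0), v + e_(s 0) + e_(s 1), ... for permutations s.  Adding to the
  coboundary of the i-th labelling the cocycle that counts crossings from x_i = N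
  to x_i = 0 does not change the value of the product, which is 1; hence some path
  contributes, and on it the i-th label changes along the i-th edge.
*)
Require Import Defs.
From HB Require Import structures.
From mathcomp Require Import all_boot all_order all_fingroup all_algebra.
From mathcomp Require Import wochoice finmap.
From mathcomp Require Import all_classical all_reals all_analysis.
From mathcomp Require Import lra.

Set Implicit Arguments.
Unset Strict Implicit.
Unset Printing Implicit Defensive.

Import Order.TTheory GRing.Theory Num.Theory.
Import numFieldNormedType.Exports.

Local Open Scope classical_set_scope.
Local Open Scope ring_scope.

(** * A discrete Poincare-Miranda theorem *)

Section LatticePaths.
Variables (G : finZmodType) (n : nat) (e : 'I_n.+1 -> G).
Implicit Types (a : G -> 'I_n.+1 -> int) (v : G) (s : 'S_n.+1).

Definition pos v s (m : nat) : G := v + \sum_(k < n.+1 | (k < m)%N) e (s k).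

Definition edge a v s (m : nat) : int := a (pos v s m) (s (inord m)).

(** Both ways round the parallelogram spanned by [e j] and [e k] give the same sum, so the value on
    its diagonal is well defined and [a] is closed on both triangles. *)
Definition cocycle a :=
  forall x j k, a x j + a (x + e j) k = a x k + a (x + e k) j.

(* Evaluation of a cochain on the fundamental cycle of the Kuhn triangulation. *)
Definition sgsum (Q : G -> 'S_n.+1 -> int) : int :=
  \sum_(s : 'S_n.+1) \sum_v (-1) ^+ s * Q v s.

(** For j < n, [adjswap j * s] takes the steps j and j+1 of [s] in the opposite order; the two paths
    from v share all vertices but the one of index j+1. *)
Definition adjswap (j : nat) : 'S_n.+1 := tperm (inord j) (inord j.+1).

Lemma pos0 v s : pos v s 0 = v.
Proof. by rewrite /pos big_pred0 ?addr0. Qed.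

Lemma posS v s m : (m <= n)%N -> pos v s m.+1 = pos v s m + e (s (inord m)).
Proof.
move=> mn; rewrite /pos (bigD1 (inord m)) ?inordK //= -addrA [e _ + _]addrC.
congr (_ + (_ + _)); apply: eq_bigl => k; rewrite ltnS (leq_eqVlt k).
have -> : (k != inord m) = (k != m :> nat).
  by rewrite -(inj_eq val_inj) /= inordK.
by case: ltngtP.
Qed.

Lemma adjswapE j (k : 'I_n.+1) : (j < n)%N -> adjswap j k =
  if k == j :> nat then inord j.+1 else if k == j.+1 :> nat then inord j else k.
Proof.
move=> jn; have jn' : (j < n.+1)%N by apply: ltnW.
have E m : (m <= n)%N -> (k == m :> nat) = (k == inord m).
  by move=> mn; rewrite -(inj_eq val_inj) /= inordK.
rewrite /adjswap !E // //.
by case: tpermP => [->|->|/eqP/negPf-> /eqP/negPf->] //;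
  rewrite ?eqxx // -(inj_eq val_inj) /= !inordK // eqn_leq ltnn.
Qed.

Lemma pos_adjswap v s j m : (j < n)%N -> m != j.+1 ->
  pos v (adjswap j * s) m = pos v s m.
Proof.
move=> jn mj; have jn' := ltnW jn; rewrite /pos [in RHS](reindex_inj (@perm_inj _ (adjswap j))) /=.
congr (_ + _); apply: eq_big => [k|k _]; last by rewrite permM.
rewrite adjswapE //; have [->|kj] := eqVneq (k : nat) j.
  by rewrite inordK // [LHS]leq_eqVlt (eq_sym j.+1) (negPf mj).
have [->|//] := eqVneq (k : nat) j.+1.
by rewrite inordK // [RHS]leq_eqVlt (eq_sym j.+1) (negPf mj).
Qed.

Lemma edge_adjswap a v s j m : (j < n)%N -> m != j -> m != j.+1 -> (m <= n)%N ->
  edge a v (adjswap j * s) m = edge a v s m.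
Proof.
move=> jn m1 m2 mn; rewrite /edge pos_adjswap // permM adjswapE // inordK //.
by rewrite (negPf m1) (negPf m2).
Qed.

Lemma cocycle_adjswap a v s j : (j < n)%N -> cocycle a ->
  edge a v (adjswap j * s) j + edge a v (adjswap j * s) j.+1 =
  edge a v s j + edge a v s j.+1.
Proof.
move=> jn ca; have jn' := ltnW jn; rewrite /edge !posS // !permM.
rewrite !adjswapE // !inordK // eqxx (gtn_eqF (ltnSn j)) eqxx.
by rewrite pos_adjswap ?(ltn_eqF (ltnSn j)) // ca.
Qed.

Lemma sgsumD P Q : sgsum (fun v s => P v s + Q v s) = sgsum P + sgsum Q.
Proof.
rewrite /sgsum -big_split; apply: eq_bigr => s _.
by rewrite -big_split; apply: eq_bigr => v _; rewrite mulrDr.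
Qed.

(** A transposition is odd, so the two simplices sharing the face opposite to vertex j+1 cancel. *)
Lemma sgsum_adjswap0 j Q : (j < n)%N ->
  (forall v s, Q v (adjswap j * s)%g = Q v s) -> sgsum Q = 0.
Proof.
move=> jn QE; have jn' := ltnW jn; suff E : sgsum Q = - sgsum Q.
  by apply/eqP; rewrite -[_ == 0]/(false || _) -(mulrn_eq0 _ 2) mulr2n {1}E addNr.
rewrite {1}/sgsum (reindex_inj (mulgI (adjswap j))) /= /sgsum -sumrN.
apply: eq_bigr => s _; rewrite -sumrN; apply: eq_bigr => v _.
rewrite odd_permM odd_tperm QE signr_addb.
have -> : inord j != inord j.+1 :> 'I_n.+1.
  by rewrite -(inj_eq val_inj) /= !inordK // ltn_eqF.
by rewrite expr1 mulN1r mulNr.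
Qed.

(* [front j] and [back j] are the products over all edges of the path but the
   j-th, the h-vertex being the end point, resp. the origin, of edge i; two
   consecutive ones add up to the value of a cup product on a face opposite to
   an interior vertex. *)
Definition front (a : 'I_n.+1 -> G -> 'I_n.+1 -> int) (h : G -> int)
    (i : 'I_n.+1) (j : nat) v s : int :=
  \prod_k if k == i then h (pos v s i.+1)
          else edge (a k) v s (k + (j <= k < i)%N).

Definition back (a : 'I_n.+1 -> G -> 'I_n.+1 -> int) (h : G -> int)
    (i : 'I_n.+1) (j : nat) v s : int :=
  \prod_k if k == i then h (pos v s i)
          else edge (a k) v s (k - (i < k <= j)%N).

Section Slot.
Variables (a : 'I_n.+1 -> G -> 'I_n.+1 -> int) (h : G -> int) (i : 'I_n.+1).
Hypothesis ca : forall k, cocycle (a k).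

(** The two products differ only in the factor of index j, taken on edge j+1 or on edge j. In their
    sum these two edges add up, and by closedness nothing depends on vertex j+1 any more. *)
Lemma front_step j : (j < i)%N ->
  sgsum (front a h i j) = - sgsum (front a h i j.+1).
Proof.
move=> ji; have jn : (j < n)%N by rewrite (leq_trans ji) // -ltnS.
have jn' := ltnW jn.
apply/eqP; rewrite -addr_eq0 -sgsumD; apply/eqP.
apply: (sgsum_adjswap0 (j := j)) => // v s.
have F t : front a h i j v t + front a h i j.+1 v t =
  (edge (a (inord j)) v t j + edge (a (inord j)) v t j.+1) *
  \prod_(k | k != inord j) if k == i then h (pos v t i.+1)
                           else edge (a k) v t (k + (j <= k < i)%N).
  have ij : (inord j == i) = false.
    by rewrite -(inj_eq val_inj) /= inordK // ltn_eqF.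
  rewrite /front (bigD1 (inord j)) //= [X in _ + X](bigD1 (inord j)) //=.
  rewrite ij !inordK // leqnn ji /= ltnn /= addn0 addn1 addrC mulrDl.
  congr (_ + _); congr (_ * _); apply: eq_bigr => k kj; case: ifP => // _.
  have {}kj : k != j :> nat.
    by move: kj; rewrite -(inj_eq val_inj) /= inordK.
  by rewrite [(j <= k)%N]leq_eqVlt eq_sym (negPf kj).
rewrite !F cocycle_adjswap //; congr (_ * _); apply: eq_bigr => k kj.
have {}kj : k != j :> nat by move: kj; rewrite -(inj_eq val_inj) /= inordK.
have kn : (k <= n)%N by rewrite -ltnS.
have i_n : (i <= n)%N by rewrite -ltnS.
case: ifP => [_|/negbT]; first by rewrite pos_adjswap // gtn_eqF // ltnS.
rewrite -(inj_eq val_inj) /= => ki.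
case: (ltngtP k j) kj => //= kj _.
  by rewrite addn0 edge_adjswap // ltn_eqF // ltnW.
case: (ltngtP k i) ki => //= ki _.
  by rewrite addn1 edge_adjswap ?gtn_eqF // ?(leq_trans ki) // ltnW.
by rewrite addn0 edge_adjswap ?gtn_eqF // (leq_trans _ ki).
Qed.

(** Mirror image of [front_step]; the factor that differs is now the one of index j+1. *)
Lemma back_step j : (i <= j)%N -> (j < n)%N ->
  sgsum (back a h i j) = - sgsum (back a h i j.+1).
Proof.
move=> ij jn; have jn' := ltnW jn.
apply/eqP; rewrite -addr_eq0 -sgsumD; apply/eqP.
apply: (sgsum_adjswap0 (j := j)) => // v s.
have F t : back a h i j v t + back a h i j.+1 v t =
  (edge (a (inord j.+1)) v t j + edge (a (inord j.+1)) v t j.+1) *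
  \prod_(k | k != inord j.+1) if k == i then h (pos v t i)
                           else edge (a k) v t (k - (i < k <= j)%N).
  have ji : (inord j.+1 == i) = false.
    by rewrite -(inj_eq val_inj) /= inordK // gtn_eqF.
  rewrite /back (bigD1 (inord j.+1)) //= [X in _ + X](bigD1 (inord j.+1)) //=.
  rewrite ji !inordK // leqnn ltnS ij ltnn /= subn0 subn1 /= addrC mulrDl.
  congr (_ + _); congr (_ * _); apply: eq_bigr => k kj; case: ifP => // _.
  have {}kj : k != j.+1 :> nat.
    by move: kj; rewrite -(inj_eq val_inj) /= inordK.
  by rewrite [(k <= j.+1)%N]leq_eqVlt (negPf kj).
rewrite !F cocycle_adjswap //; congr (_ * _); apply: eq_bigr => k kj.
have {}kj : k != j.+1 :> nat by move: kj; rewrite -(inj_eq val_inj) /= inordK.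
have kn : (k <= n)%N by rewrite -ltnS.
case: ifP => [_|/negbT]; first by rewrite pos_adjswap // ltn_eqF.
rewrite -(inj_eq val_inj) /= => ki.
case: (ltngtP i k) ki => //= ki _; last first.
  by rewrite subn0 edge_adjswap // ltn_eqF // (leq_trans ki) // ltnW.
case: leqP => kj' /=.
  have kk : (k - 1 < j)%N by rewrite (leq_trans _ kj') // subn1 prednK // (leq_ltn_trans _ ki).
  apply: edge_adjswap => //; first by rewrite ltn_eqF.
    by rewrite ltn_eqF // ltnW.
  exact: leq_trans (leq_subr _ _) kn.
by rewrite subn0 edge_adjswap // gtn_eqF.
Qed.

(** The cycle m -> m+1, n -> 0: the path of [cyc * s] from the second vertex of a path follows it
    from there and repeats its first step at the end. *)
Definition cyc : 'S_n.+1 := lift_perm ord_max ord0 1.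

Lemma cycE m : (m < n)%N -> cyc (inord m) = inord m.+1.
Proof.
move=> mn; have -> : inord m = lift ord_max (Ordinal mn).
  by apply: val_inj; rewrite /= inordK ?/bump ?[(n <= m)%N]leqNgt ?mn // ltnS ltnW.
rewrite /cyc lift_perm_lift perm1; apply: val_inj => /=.
by rewrite /= inordK.
Qed.

Lemma pos_cyc v s m : (m <= n)%N ->
  pos (v + e (s ord0)) (cyc * s)%g m = pos v s m.+1.
Proof.
elim: m => [_|m IH mn].
  by rewrite pos0 posS // pos0; congr (_ + e (s _)); apply: val_inj; rewrite /= inordK.
by rewrite posS ?IH ?(ltnW mn) // [RHS]posS // permM cycE.
Qed.

Lemma edge_cyc b v s m : (m < n)%N ->
  edge b (v + e (s ord0)) (cyc * s)%g m = edge b v s m.+1.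
Proof. by move=> mn; rewrite /edge pos_cyc ?(ltnW mn) // permM cycE. Qed.

(** The face opposite to the first vertex of a simplex is the face opposite to the last vertex of
    another one, as there is no boundary. The sign is that of [cyc], a cycle of length n+1. *)
Lemma front_back : sgsum (front a h i 0) = (-1) ^+ n * sgsum (back a h i n).
Proof.
rewrite [in RHS]/sgsum (reindex_inj (mulgI cyc)) /= /sgsum mulr_sumr.
apply: eq_bigr => s _; rewrite mulr_sumr [RHS](reindex_inj (addIr (e (s ord0)))) /=.
apply: eq_bigr => v _.
rewrite odd_permM odd_lift_perm odd_perm1 addbF signr_addb /= addbF signr_odd.
rewrite !mulrA -expr2 sqrr_sign mul1r; congr (_ * _).
rewrite /front /back; apply: eq_bigr => k _.
have kn : (k <= n)%N by rewrite -ltnS.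
have i_n : (i <= n)%N by rewrite -ltnS.
case: ifP => [_|/negbT]; first by rewrite pos_cyc.
rewrite -(inj_eq val_inj) /= kn andbT.
case: (ltngtP k i) => //= ki _.
  by rewrite subn0 addn1 edge_cyc // (leq_trans ki).
have k0 : (0 < k)%N by apply: leq_ltn_trans ki.
by rewrite addn0 subn1 edge_cyc ?prednK.
Qed.

(** The product splits as [front] minus [back] with edge i missing. Moving the missing edge from i
    to 0, across [front_back] to n, and back down to i changes the sign i + n + (n - i) times, an
    even number, so both parts have the same sum. *)
Lemma sgsum_coboundary :
  sgsum (fun v s => \prod_k
    if k == i then h (pos v s i.+1) - h (pos v s i) else edge (a k) v s k) = 0.
Proof.
have i_n : (i <= n)%N by rewrite -ltnS.
have fr j : (j <= i)%N -> sgsum (front a h i 0) = (-1) ^+ j * sgsum (front a h i j).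
  elim: j => [|j IH] ji; first by rewrite expr0 mul1r.
  by rewrite IH ?(ltnW ji) // front_step // exprS mulrN !mulNr mul1r.
have bk j : (i + j <= n)%N ->
    sgsum (back a h i i) = (-1) ^+ j * sgsum (back a h i (i + j)).
  elim: j => [|j IH] ji; first by rewrite expr0 mul1r addn0.
  rewrite addnS in ji *.
  by rewrite IH ?(ltnW ji) // back_step ?leq_addr // exprS mulrN !mulNr mul1r.
have E : sgsum (front a h i i) = sgsum (back a h i i).
  apply: (mulfI (_ : (-1) ^+ i != 0 :> int)); first by rewrite signr_eq0.
  rewrite -fr // front_back (bk (n - i)%N) ?subnKC // mulrA -exprD.
  by rewrite subnKC.
move/eqP: E; rewrite -subr_eq0 => /eqP <-; apply/eqP.
rewrite eq_sym subr_eq -sgsumD; apply/eqP.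
apply: eq_bigr => s _; apply: eq_bigr => v _; congr (_ * _).
apply/eqP; rewrite -subr_eq; apply/eqP.
rewrite /front /back !(bigD1 i (P := predT)) //= !eqxx mulrBl.
congr (_ - _); congr (_ * _); apply: eq_bigr => k /negPf-> //.
  by case: (ltngtP k i); rewrite ?andbF ?addn0 //= => /ltnW; rewrite leqNgt => /negPf->.
by case: (ltngtP k i); rewrite ?andbF ?subn0.
Qed.

End Slot.
End LatticePaths.

(** * Label changes along paths in a discrete torus *)

Section Torus.
Variables (N n : nat).
Local Notation G := 'rV['I_N.+1]_n.+1.
Implicit Types (v x : G) (s : 'S_n.+1).

(** [inZp 1] makes sense in the cyclic group for every N, including N = 0. *)
Definition unit_step (j : 'I_n.+1) : G := \row_k if k == j then inZp 1 else 0.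

Lemma pos_coord v s m j : pos unit_step v s m 0 j =
  v 0 j + if ((s^-1)%g j < m)%N then inZp 1 else 0.
Proof.
rewrite /pos mxE summxE big_mkcond (bigD1 ((s^-1)%g j)) //= big1 => [|k kj].
  by rewrite addr0 mxE permKV eqxx.
case: ifP => // _; rewrite mxE ifN //; apply: contraNneq kj => ->.
by rewrite permK.
Qed.

Variable l : 'I_n.+1 -> G -> bool.
Hypothesis l0 : forall k x, x 0 k = 0 -> l k x = false.
Hypothesis l1 : forall k x, x 0 k = ord_max -> l k x = true.

Definition crossing (k : 'I_n.+1) x (j : 'I_n.+1) : int :=
  ((j == k) && (x 0 k == ord_max))%:R.

(* The labels contribute only to the factors [k >= m]: m = n.+1 gives the
   cocycles dual to the coordinate directions, m = 0 the labelled ones. *)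
Definition label_cocycle (m : nat) (k : 'I_n.+1) x (j : 'I_n.+1) : int :=
  crossing k x j +
    if (m <= k)%N then (l k (x + unit_step j))%:R - (l k x)%:R else 0.

Lemma label_cocycleP m k : cocycle unit_step (label_cocycle m k).
Proof.
move=> x i j; rewrite /label_cocycle.
have E : crossing k x i + crossing k (x + unit_step i) j =
         crossing k x j + crossing k (x + unit_step j) i.
  have [->|ij] := eqVneq i j; first by [].
  have U i' : i' != k -> (x + unit_step i') 0 k = x 0 k.
    by move=> ik; rewrite !mxE ifN ?addr0 // eq_sym.
  rewrite /crossing; have [ik|ik] := eqVneq i k; have [jk|jk] := eqVneq j k => //=.
  - by rewrite ik jk eqxx in ij.
  - by rewrite U // addrC.
  - by rewrite U // addrC.
rewrite addrACA E [RHS]addrACA; congr (_ + _).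
case: ifP => // _; rewrite addrC subrKA [RHS]addrC subrKA.
by rewrite -!addrA [unit_step i + _]addrC.
Qed.

(** The two families differ only in the factor of index m, by the coboundary of [l (inord m)];
    multilinearity reduces the claim to [sgsum_coboundary]. *)
Lemma label_cocycle_coboundary m : (m <= n)%N ->
  sgsum (fun v s => \prod_k edge unit_step (label_cocycle m k) v s k) =
  sgsum (fun v s => \prod_k edge unit_step (label_cocycle m.+1 k) v s k).
Proof.
move=> mn.
have := @sgsum_coboundary _ _ unit_step (label_cocycle m)
  (fun x => (l (inord m) x)%:R) (inord m) (label_cocycleP m).
move=> /(congr1 (fun z => z + sgsum (fun v s =>
  \prod_k edge unit_step (label_cocycle m.+1 k) v s k))).
rewrite add0r => <-; rewrite -sgsumD.
apply: eq_bigr => s _; apply: eq_bigr => v _; congr (_ * _).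
rewrite !(bigD1 (inord m) (P := predT)) //= eqxx inordK //.
rewrite [X in _ = _ + _ * X](eq_bigr (fun k : 'I_n.+1 =>
  edge unit_step (label_cocycle m k) v s k)); last first.
  move=> k; rewrite -(inj_eq val_inj) /= inordK // => km.
  by rewrite /edge /label_cocycle ltn_neqAle eq_sym km.
rewrite [X in _ = _ * X + _](eq_bigr (fun k : 'I_n.+1 =>
  edge unit_step (label_cocycle m k) v s k)); last by move=> k /negPf->.
rewrite -mulrDl; congr (_ * _).
rewrite /edge /label_cocycle posS // inordK // leqnn ltnn addr0.
by rewrite addrC.
Qed.

(** Exactly one term survives: edge k must point in direction k for every k, so [s] is the identity;
    then coordinate k is still that of v at vertex k, so all coordinates of v equal N. *)
Lemma sgsum_crossing :
  sgsum (fun v s => \prod_k edge unit_step (label_cocycle n.+1 k) v s k) = 1.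
Proof.
have wE (k : 'I_n.+1) x j : label_cocycle n.+1 k x j = crossing k x j.
  by rewrite /label_cocycle ltnNge -ltnS ltn_ord addr0.
rewrite /sgsum (bigD1 (1%g : 'S_n.+1)) //= [X in _ + X]big1 => [|s s1].
  rewrite (bigD1 (const_mx ord_max)) //= [X in _ + X + _]big1 => [|v vc].
    rewrite !addr0 odd_perm1 mul1r big1 // => k _.
    rewrite /edge wE /crossing perm1 inord_val eqxx pos_coord invg1 perm1 ltnn.
    by rewrite addr0 mxE eqxx.
  have [k vk] : exists k, v 0 k != ord_max.
    apply/existsP; apply: contraNT vc; rewrite negb_exists => /forallP vm.
    apply/eqP/rowP => k; rewrite mxE; apply/eqP; move: (vm k).
    by rewrite negbK.
  rewrite (bigD1 k) //= /edge wE /crossing pos_coord invg1 !perm1 ltnn addr0.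
  by rewrite (negPf vk) andbF mul0r mulr0.
have [k sk] : exists k, s k != k.
  apply/existsP; apply: contraNT s1; rewrite negb_exists => /forallP vm.
  apply/eqP/permP => k; rewrite perm1; apply/eqP; move: (vm k).
  by rewrite negbK.
apply: big1 => v _; rewrite (bigD1 k) //= /edge wE /crossing inord_val (negPf sk).
by rewrite mul0r mulr0.
Qed.

Lemma label_change_path : exists v s,
  (forall j, v 0 j != ord_max) /\
  forall k, l k (pos unit_step v s k) != l k (pos unit_step v s k.+1).
Proof.
have S1 : sgsum (fun v s => \prod_k edge unit_step (label_cocycle 0 k) v s k) = 1.
  suff E m : (m <= n.+1)%N ->
      sgsum (fun v s => \prod_k edge unit_step (label_cocycle 0 k) v s k) =
      sgsum (fun v s => \prod_k edge unit_step (label_cocycle m k) v s k).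
    by rewrite (E n.+1) // sgsum_crossing.
  elim: m => // m IH mn; rewrite IH ?(ltnW mn) //.
  exact: label_cocycle_coboundary.
have [/existsP[s /existsP[v nz]]|none] := boolP [exists s : 'S_n.+1, [exists v,
    \prod_k edge unit_step (label_cocycle 0 k) v s k != 0]]; last first.
  move: S1; rewrite /sgsum big1 // => s _; apply: big1 => v _.
  move: none; rewrite negb_exists => /forallP/(_ s).
  by rewrite negb_exists => /forallP/(_ v); rewrite negbK => /eqP->; rewrite mulr0.
have {}nz k : edge unit_step (label_cocycle 0 k) v s k != 0.
  by move/prodf_neq0: nz; apply.
have kn (k : 'I_n.+1) : (k <= n)%N by rewrite -ltnS.
have max1 : ord_max + inZp 1 = 0 :> 'I_N.+1.
  by apply: val_inj; rewrite /= modnDmr addn1 modnn.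
have nzE k : crossing k (pos unit_step v s k) (s k) +
  ((l k (pos unit_step v s k.+1))%:R - (l k (pos unit_step v s k))%:R) != 0.
  by move: (nz k); rewrite /edge /label_cocycle leq0n inord_val posS // inord_val.
(* Suppose v has j-th coordinate N. If edge j moves coordinate j, the crossing 1 cancels against the
   label dropping from true to false. Otherwise both ends of edge j have j-th coordinate 0, or both
   have N, so the labels agree and no crossing occurs. Either way factor j vanishes. *)
have nowrap j : v 0 j != ord_max.
  apply: contraNneq (nzE j) => vj; rewrite /crossing.
  have [sj|sj] := eqVneq (s j) j.
    have sj' : (s^-1)%g j = j by rewrite -{1}sj permK.
    rewrite pos_coord sj' ltnn addr0 vj eqxx /=.
    rewrite l0 ?pos_coord ?sj' ?ltnS ?leqnn ?vj //.
    by rewrite l1 ?pos_coord ?sj' ?ltnn ?addr0 ?vj.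
  rewrite add0r.
  have : (s^-1)%g j != j by apply: contraNneq sj => {1}<-; rewrite permKV.
  rewrite -(inj_eq val_inj) /=; case: ltngtP => // tj _.
    by rewrite !l0 // pos_coord ?ltnS ?(ltnW tj) ?tj vj.
  by rewrite !l1 // pos_coord ltnNge ?tj ?(ltnW tj) /= addr0 vj.
exists v, s; split=> // k; apply: contraNneq (nzE k) => ->; rewrite subrr addr0.
rewrite /crossing; have [sk|//] := eqVneq (s k) k.
have -> : pos unit_step v s k 0 k = v 0 k.
  have sk' : (s^-1)%g k = k by rewrite -{1}sk permK.
  by rewrite pos_coord sk' ltnn addr0.
by rewrite (negPf (nowrap k)).
Qed.

End Torus.

(** The start v of the path has no coordinate N, so the path stays in the cube with lowest corner v
    without wrapping around. *)
Lemma discrete_poincare_miranda (N d : nat)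
    (l : 'I_d -> 'rV['I_N.+1]_d -> bool)
    (l0 : forall k (x : 'rV['I_N.+1]_d), x 0 k = 0 -> l k x = false)
    (l1 : forall k (x : 'rV['I_N.+1]_d), x 0 k = ord_max -> l k x = true) :
  exists w : 'rV['I_N.+1]_d, forall k, exists p q : 'rV['I_N.+1]_d,
    [/\ l k p != l k q, forall j, (w 0%R j <= p 0%R j <= (w 0%R j).+1)%N
      & forall j, (w 0%R j <= q 0%R j <= (w 0%R j).+1)%N].
Proof.
case: d l l0 l1 => [|n] l l0 l1; first by exists 0; case.
have [v [s [vN lv]]] := label_change_path l0 l1.
exists v => k; exists (pos (@unit_step N n) v s k), (pos (@unit_step N n) v s k.+1).
suff P m j : (v 0%R j <= pos (@unit_step N n) v s m 0%R j <= (v 0%R j).+1)%N.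
  by split=> // j; exact: P.
have vj : ((v 0%R j).+1 < N.+1)%N.
  by move: (vN j); rewrite -(inj_eq val_inj) /= ltn_neqAle ltn_ord andbT eqSS.
rewrite pos_coord; case: ifP => _; last by rewrite addr0 leqnn leqnSn.
by rewrite /= modnDmr addn1 modn_small // leqnn leqnSn.
Qed.

(** * Continuous approximation of coarsely continuous maps *)

Section NonnegSup.
Variables (R : realType) (T : Type).
Implicit Types (A : set T) (f g : T -> R).

(** Adjoining 0 keeps the set nonempty, so an empty [A] gives 0. *)
Definition nnsup A f : R := sup ([set 0] `|` [set f z | z in A]).

Lemma le_nnsup A f b z : (forall y, f y <= b) -> A z -> f z <= nnsup A f.
Proof.
move=> fb Az; apply: ub_le_sup; last by right; exists z.
by exists (Num.max 0 b) => _ [->|[y _ <-]]; rewrite le_max ?lexx ?fb ?orbT.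
Qed.

Lemma nnsup_ge0 A f b : (forall y, f y <= b) -> 0 <= nnsup A f.
Proof.
move=> fb; apply: ub_le_sup; last by left.
by exists (Num.max 0 b) => _ [->|[y _ <-]]; rewrite le_max ?lexx ?fb ?orbT.
Qed.

Lemma nnsup_le A f c : 0 <= c -> (forall z, A z -> f z <= c) -> nnsup A f <= c.
Proof.
move=> c0 fc; apply: ge_sup; first by exists 0; left.
by move=> _ [->|[z Az <-]] //; apply: fc.
Qed.

Lemma nnsup_lipschitz A f g b c : 0 <= c -> (forall y, g y <= b) ->
  (forall z, f z <= g z + c) -> nnsup A f <= nnsup A g + c.
Proof.
move=> c0 gb fg; apply: nnsup_le => [|z Az]; first by rewrite addr_ge0 ?(nnsup_ge0 _ gb).
by rewrite (le_trans (fg z)) // lerD2r (le_nnsup gb).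
Qed.

Lemma nnsup_gt A f c : 0 <= c -> c < nnsup A f -> exists2 z, A z & c < f z.
Proof.
move=> c0 cs; apply: contrapT => none; move: cs; apply/negP; rewrite -leNgt.
apply: nnsup_le => // z Az; rewrite leNgt; apply/negP => cz.
by apply: none; exists z.
Qed.

End NonnegSup.

(** * A locally finite family of Lipschitz weights *)

Section LocallyFiniteWeights.
Variables (R : realType) (X : normedModType R) (r : rel X).
Hypothesis r_wo : well_order r.

Definition before (z' z : X) : Prop := r z' z /\ z' != z.

Lemma before_min (A : set X) : A !=set0 ->
  exists2 z, A z & forall z', A z' -> z' != z -> before z z'.
Proof.
case=> x Ax; have [|z [[zA zmin] _]] := r_wo (A := [in A]).
  by exists x; exact: mem_set.
exists z; first exact: set_mem.
by move=> z' Az' zz'; split; [apply: zmin; exact: mem_set | rewrite eq_sym].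
Qed.

Definition bump (z x : X) : R := Num.max 0 (1 - `|x - z|).

(* As [nu z x] is the increment, at stage z, of the transfinite running maximum
   of the bumps, which stays in [0, 1], at most 1 / eta of the values nu z x
   can exceed a given eta > 0. *)
Definition nu z x : R :=
  Num.max 0 (bump z x - nnsup [set z' | before z' z] (bump^~ x)).

Definition top x : R := nnsup setT (nu^~ x).

(** Cutting at half of the largest increment leaves at least one and at most finitely many positive
    weights, and this finiteness persists near x since [top] is positive and Lipschitz. *)
Definition weight z x : R := Num.max 0 (nu z x - top x / 2).

Lemma maxr0_le (a b c : R) : 0 <= c -> a <= b + c -> Num.max 0 a <= Num.max 0 b + c.
Proof.
move=> c0 ab; rewrite ge_max; apply/andP; split.
  by rewrite addr_ge0 // le_max lexx.
by rewrite (le_trans ab) // lerD2r le_max lexx orbT.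
Qed.

Lemma bump_le1 z x : bump z x <= 1.
Proof. by rewrite /bump ge_max ler01 lerBlDr lerDl normr_ge0. Qed.

Lemma bump_lipschitz z x y : bump z x <= bump z y + `|x - y|.
Proof.
apply: maxr0_le => //; have := ler_normD (y - x) (x - z).
by rewrite addrA subrK (distrC y x); lra.
Qed.

Lemma nu_le1 z x : nu z x <= 1.
Proof.
rewrite /nu ge_max ler01 /=; have := bump_le1 z x.
by have := nnsup_ge0 [set z' | before z' z] (bump_le1^~ x); lra.
Qed.

Lemma nu_lipschitz z x y : nu z x <= nu z y + 2 * `|x - y|.
Proof.
apply: maxr0_le; first by rewrite mulr_ge0.
have := bump_lipschitz z x y.
have := @nnsup_lipschitz R X [set z' | before z' z] (bump^~ y) (bump^~ x) 1
  `|x - y| (normr_ge0 _) (bump_le1^~ x).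
move=> /(_ _)/wrap[w|]; first by have := bump_lipschitz w y x; rewrite distrC.
lra.
Qed.

Lemma top_lipschitz x y : top x <= top y + 2 * `|x - y|.
Proof.
apply: (nnsup_lipschitz setT (b := 1)); first by rewrite mulr_ge0.
  by move=> z; apply: nu_le1.
by move=> z; apply: nu_lipschitz.
Qed.

(** The constant is 2 from [nu] plus 1 from half of [top]. *)
Lemma weight_lipschitz z x y : weight z x <= weight z y + 3 * `|x - y|.
Proof.
apply: maxr0_le; first by rewrite mulr_ge0.
by have := nu_lipschitz z x y; have := top_lipschitz y x; rewrite (distrC y x); lra.
Qed.

Lemma continuous_weight z : continuous (weight z).
Proof.
move=> x; apply/cvgrPdist_lt => e e0.
have e4 : 0 < e / 4 by rewrite divr_gt0.
near=> y; have : `|x - y| < e / 4 by near: y; exact: cvgr_dist_lt.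
have := weight_lipschitz z x y; have := weight_lipschitz z y x.
by rewrite (distrC y x) ltr_norml; lra.
Unshelve. all: by end_near.
Qed.

(** The first z whose bump at x exceeds 1/2 has a positive increment, since all earlier bumps are at
    most 1/2. *)
Lemma top_gt0 x : 0 < top x.
Proof.
have [|z zA zmin] := @before_min [set z | 1 / 2 < bump z x].
  by exists x; rewrite /= /bump subrr normr0 subr0 lt_max; apply/orP; right; lra.
apply: lt_le_trans (le_nnsup (b := 1) _ (I : setT z)); last exact: (nu_le1^~ x).
rewrite lt_max; apply/orP; right; rewrite subr_gt0.
apply: le_lt_trans zA; apply: nnsup_le => [|z' [rz' z'z]]; first lra.
rewrite leNgt; apply/negP => z'A; have [rzz' _] := zmin _ z'A z'z.
have /wo_chain_antisymmetric anti : wo_chain r predT by move=> A _; exact: r_wo.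
by move/eqP: z'z; apply; apply: anti => //; rewrite rz'.
Qed.

Lemma nu_gt_finite x eta : 0 < eta -> finite_set [set z | eta < nu z x].
Proof.
move=> eta0; apply: contrapT => inf.
(* Here b bounds from below the running maximum before every point of [s]. Removing the first point
   of [s] raises this bound by eta, and bumps never exceed 1. *)
have count (m : nat) (b : R) (s : {fset X}) :
    #|` s| = m -> b <= 1 ->
    (forall z, z \in s -> eta < nu z x /\
      b <= nnsup [set z' | before z' z] (bump^~ x)) ->
    b + m%:R * eta <= 1.
  elim: m => [|m IH] in b s *; first by rewrite mul0r addr0.
  move=> sm b1 sP; have [|z zs zmin] := @before_min [set` s].
    by have /fset0Pn[z zs] : s != fset0 by [rewrite -cardfs_gt0 sm]; exists z.
  have [etaz bz] := sP z zs.
  have bumpz : b + eta <= bump z x.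
    move: etaz; rewrite /nu lt_max ltNge (ltW eta0) /=; lra.
  have := IH (b + eta) (s `\ z)%fset.
  rewrite -addrA -natr1 mulrDl mul1r [_ * _ + _]addrC; apply.
  - by move: sm; rewrite (cardfsD1 z) zs => -[].
  - exact: le_trans bumpz (bump_le1 z x).
  move=> z'; rewrite !inE => /andP[z'z z's]; split; first by case: (sP z' z's).
  apply: le_trans bumpz _; apply: (@le_nnsup _ _ _ (bump^~ x) 1 z); first exact: (bump_le1^~ x).
  exact: zmin.
have [B BA Bn] := infinite_set_fset (Num.truncn (eta^-1)).+1 inf.
have := count _ 0 B erefl ler01 => /(_ _)/wrap[z zB|].
  by split; [exact: BA | exact: (nnsup_ge0 _ (bump_le1^~ x))].
rewrite add0r; apply/negP; rewrite -ltNge -[ltLHS](mulVf (lt0r_neq0 eta0)).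
by rewrite ltr_pM2r // (lt_le_trans (truncnS_gt _)) // ler_nat.
Qed.

Lemma weight_gt0 z x : 0 < weight z x -> top x / 2 < nu z x.
Proof. by rewrite /weight lt_max ltxx /= subr_gt0. Qed.

Lemma weight_ge0 z x : 0 <= weight z x.
Proof. by rewrite /weight le_max lexx. Qed.

Lemma weight_support z x : 0 < weight z x -> `|x - z| < 1.
Proof.
move=> /weight_gt0; have t0 := top_gt0 x => tn.
have : 0 < nu z x by lra.
rewrite /nu lt_max ltxx /= subr_gt0 => lb.
have : 0 < bump z x.
  by apply: le_lt_trans lb; apply: (nnsup_ge0 _ (b := 1)); exact: (bump_le1^~ x).
by rewrite /bump lt_max ltxx /=; lra.
Qed.

Lemma weight_pos x : exists z, 0 < weight z x.
Proof.
have t0 := top_gt0 x; have [||z _ tz] := @nnsup_gt R X setT (nu^~ x) (top x / 2).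
- lra.
- by rewrite -/(top x); lra.
- by exists z; rewrite /weight lt_max subr_gt0 tz orbT.
Qed.

Lemma weight_locally_finite (x : X) : exists A : {fset X},
  \forall y \near x, forall z, z \notin A -> weight z y = 0.
Proof.
have t0 := top_gt0 x; have t4 : 0 < top x / 4 by lra.
have [A AE] := finite_fsetP.1 (nu_gt_finite x t4).
exists A; near=> y => z; apply: contraNeq => wz.
have /weight_gt0 : 0 < weight z y by rewrite lt_neqAle eq_sym wz weight_ge0.
(* Then [top y] exceeds 7/8 of [top x], and [nu z] changes by less than [top x / 8]; so [nu z x]
   exceeds 7/16 - 2/16 > 1/4 of [top x]. *)
have xy : `|x - y| < top x / 16.
  by near: y; apply: cvgr_dist_lt => //; lra.
have := nu_lipschitz z y x; have := top_lipschitz x y; rewrite (distrC y x) => h1 h2 h3.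
have : [set z | top x / 4 < nu z x] z by rewrite /=; lra.
by rewrite AE.
Unshelve. all: by end_near.
Qed.

End LocallyFiniteWeights.

(** [U x] is a convex combination of values [F z] with z at distance less than 1 from x, each within
    D of [F x]. *)
Lemma continuous_approximation (R : realType) (X Y : normedModType R)
    (F : X -> Y) (D : R)
    (FD : forall x x', `|x - x'| <= 1 -> `|F x - F x'| <= D) :
  exists U : X -> Y, continuous U /\ forall x, `|U x - F x| <= D.
Proof.
have [r r_wo] := well_ordering_principle X.
pose w := weight r.
pose den x := \sum_(z \in [set: X]) w z x.
pose num x := \sum_(z \in [set: X]) w z x *: F z.
(* Near x both sums over all of X reduce to sums over one fixed finite set, which gives
   continuity. *)
have local (x : X) : exists A : {fset X}, \forall y \near x,
    [/\ forall z, z \notin A -> w z y = 0, den y = \sum_(z <- A) w z y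
      & num y = \sum_(z <- A) w z y *: F z].
  have [A Ax] := weight_locally_finite r_wo x; exists A.
  apply: filterS Ax => y Ay; split=> //; apply: fsbigTE => z zA; first exact: Ay.
  by rewrite /w Ay // scale0r.
have den_gt0 (x : X) : 0 < den x.
  have [A /nbhs_singleton[supp -> _]] := local x.
  have [z wz] := weight_pos r_wo x.
  have [zA|/supp] := boolP (z \in A); last by move/eqP; rewrite gt_eqF.
  rewrite (big_rem z zA) ltr_wpDr // sumr_ge0 // => y _; exact: weight_ge0.
exists (fun x => (den x)^-1 *: num x); split=> x.
  have [A nearA] := local x.
  have [_ dA nA] := nbhs_singleton nearA.
  have E : \forall y \near x, (\sum_(z <- A) w z y)^-1 *: (\sum_(z <- A) w z y *: F z)
      = (den y)^-1 *: num y.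
    by apply: filterS nearA => y [_ -> ->].
  apply: (cvg_trans (near_eq_cvg E)).
  rewrite dA nA; apply: cvgZ.
    apply: cvgV; first by rewrite -dA gt_eqF.
    apply: cvg_big => [|z _]; first exact: add_continuous.
     exact: continuous_weight.
  apply: cvg_big => [|z _]; first exact: add_continuous.
   apply: cvgZr_tmp; exact: continuous_weight.
have [A /nbhs_singleton[_ dA nA]] := local x.
have -> : (den x)^-1 *: num x - F x =
    (den x)^-1 *: \sum_(z <- A) w z x *: (F z - F x).
  rewrite -[F x in LHS]scale1r -(mulVf (lt0r_neq0 (den_gt0 x))) -scalerA -scalerBr.
  congr (_ *: _); rewrite dA nA scaler_suml -sumrB.
  by apply: eq_bigr => z _; rewrite scalerBr.
rewrite normrZ ger0_norm ?invr_ge0 ?(ltW (den_gt0 x)) //.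
rewrite mulrC ler_pdivrMr // mulrC dA mulr_suml.
apply: le_trans (ler_norm_sum _ _ _) _; apply: ler_sum => z _.
rewrite normrZ ger0_norm ?weight_ge0 //.
have [->|wz] := eqVneq (w z x) 0; first by rewrite !mul0r.
rewrite ler_wpM2l ?weight_ge0 //; apply: FD.
have : 0 < w z x by rewrite lt_neqAle eq_sym wz weight_ge0.
by move=> /(weight_support r_wo)/ltW; rewrite distrC.
Qed.

(** * Net equivalences *)

Definition coarse_lipschitz (R : realType) (X Y : normedModType R) (K : R)
    (F : X -> Y) : Prop :=
  forall x x', `|F x - F x'| <= K * (`|x - x'| + 1).

Lemma lipschitz_coarse_lipschitz (R : realType) (X Y : normedModType R)
    (M : set X) (f : X -> Y) (b : R) (p : X -> X) :
  [lipschitz f x | x in M] ->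
  (forall x, M (p x) /\ `|x - p x| < b) ->
  exists K : R, [/\ 0 < K, forall x x', M x -> M x' -> `|f x - f x'| <= K * `|x - x'|
    & coarse_lipschitz K (f \o p)].
Proof.
(* The Lipschitz bound is available for every constant above k; this one is also positive. *)
move=> [k [_ fk]] pM; pose k' := `|k| + 1.
have k'0 : 0 < k' by rewrite ltr_wpDl.
have fL x x' : M x -> M x' -> `|f x - f x'| <= k' * `|x - x'|.
  move=> Mx Mx'; have kk : k < k' by rewrite ltr_pwDr // ler_norm.
  exact: (fk _ kk (x, x')).
have b0 : 0 < b by apply: le_lt_trans (pM 0).2.
have k'K : k' <= k' * (1 + 2 * b) by rewrite ler_peMr ?ltW //; lra.
exists (k' * (1 + 2 * b)); split.
- by rewrite (lt_le_trans k'0).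
- move=> x x' Mx Mx'; apply: le_trans (fL _ _ Mx Mx') _.
  by rewrite ler_wpM2r.
move=> x x' /=; apply: le_trans (fL _ _ (pM x).1 (pM x').1) _.
rewrite -mulrA ler_wpM2l ?ltW //.
have : `|p x - p x'| <= `|x - x'| + 2 * b.
  have -> : p x - p x' = (x - x') + ((x' - p x') - (x - p x)).
    by rewrite opprB addrA subrKA addrC subrKA.
  apply: le_trans (ler_normD _ _) _; rewrite lerD2l.
  apply: le_trans (ler_normB _ _) _.
  by have := (pM x).2; have := (pM x').2; lra.
have : 0 <= `|x - x'| * b by rewrite mulr_ge0 // ltW.
nra.
Qed.

(** The infimum of the distances may not be attained, so [p x] is merely some net point closer than
    b. *)
Lemma net_nearest (R : realType) (X : normedModType R) (M : set X) : net M ->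
  exists b : R, exists p : X -> X, forall x, M (p x) /\ `|x - p x| < b.
Proof.
move=> [a [b [_ _ [_ near]]]]; exists b.
suff /choice[p pM] : forall x, exists z, M z /\ `|x - z| < b by exists p.
move=> x; have /ereal_inf_lt[_ [z Mz <-]] := near x.
by move=> /edist_lt_ball; rewrite -ball_normE; exists z.
Qed.

Lemma net_equivalent_coarse (R : realType) (X Y : normedModType R) :
  net_equivalent X Y -> exists (F : X -> Y) (G : Y -> X) (K : R),
    [/\ 0 < K, coarse_lipschitz K F, coarse_lipschitz K G,
        forall x, `|G (F x) - x| <= K & forall y, `|F (G y) - y| <= K].
Proof.
move=> [M [N [netM netN [f [g [fMN fK fL gL]]]]]].
have [b [p pM]] := net_nearest netM; have [c [q qN]] := net_nearest netN.
have [KF [KF0 KfL KFL]] := lipschitz_coarse_lipschitz fL pM.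
have [KG [KG0 KgL KGL]] := lipschitz_coarse_lipschitz gL qN.
have [fN _ fS] := fMN.
have gM y : N y -> M (g y) /\ f (g y) = y.
  by move=> /fS[x Mx <-]; rewrite fK ?inE.
have b0 : 0 < b by apply: le_lt_trans (pM 0).2.
have c0 : 0 < c by apply: le_lt_trans (qN 0).2.
(* Large enough for the slopes KF and KG and for the round-trip errors KG c + b and KF b + c. *)
pose K := KF * (c + b + 1) + KG * (c + b + 1) + b + c.
have cb0 : 0 <= c + b by lra.
have KFb : 0 <= KF * (c + b) by rewrite mulr_ge0 // ltW.
have KGb : 0 <= KG * (c + b) by rewrite mulr_ge0 // ltW.
have KFb' : 0 <= KF * b by rewrite mulr_ge0 // ltW.
have KGb' : 0 <= KG * c by rewrite mulr_ge0 // ltW.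
have KFc' : 0 <= KF * c by rewrite mulr_ge0 // ltW.
have KGc' : 0 <= KG * b by rewrite mulr_ge0 // ltW.
exists (f \o p), (g \o q), K; split.
- by rewrite /K; nra.
- move=> x x'; apply: le_trans (KFL x x') _; rewrite ler_wpM2r ?addr_ge0 //.
  by rewrite /K; lra.
- move=> x x'; apply: le_trans (KGL x x') _; rewrite ler_wpM2r ?addr_ge0 //.
  by rewrite /K; lra.
- move=> x /=; have [Mx xb] := pM x; have fx := fN _ Mx.
  have [Nq qb] := qN (f (p x)).
  have -> : g (q (f (p x))) - x = (g (q (f (p x))) - g (f (p x))) + (p x - x).
    by rewrite fK ?inE // addrA subrK.
  apply: le_trans (ler_normD _ _) _.
  have := KgL _ _ Nq fx; rewrite (distrC (q _)) (distrC (p x)) => h.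
  have : KG * `|f (p x) - q (f (p x))| <= KG * c by rewrite ler_wpM2l // ltW.
  by rewrite /K; lra.
move=> y /=; have [Ny yc] := qN y; have [gy fgy] := gM _ Ny.
have [Mp pb] := pM (g (q y)).
have -> : f (p (g (q y))) - y = (f (p (g (q y))) - f (g (q y))) + (q y - y).
  by rewrite fgy addrA subrK.
apply: le_trans (ler_normD _ _) _.
have := KfL _ _ Mp gy; rewrite (distrC (p _)) (distrC (q y)) => h.
have : KF * `|g (q y) - p (g (q y))| <= KF * b by rewrite ler_wpM2l // ltW.
by rewrite /K; lra.
Qed.

Lemma net_equivalent_continuous (R : realType) (X Y : normedModType R) :
  net_equivalent X Y -> exists (U : X -> Y) (V : Y -> X) (K : R),
    [/\ continuous U /\ continuous V, 0 < K,
        coarse_lipschitz K U /\ coarse_lipschitz K V,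
        forall x, `|V (U x) - x| <= K & forall y, `|U (V y) - y| <= K].
Proof.
move=> /net_equivalent_coarse[F [G [K [K0 FL GL GF FG]]]].
have near1 (E E' : normedModType R) (H : E -> E') : coarse_lipschitz K H ->
    forall x x', `|x - x'| <= 1 -> `|H x - H x'| <= 2 * K.
  by move=> HL x x' xx'; apply: le_trans (HL x x') _; nra.
have [U [Uc UF]] := continuous_approximation (near1 _ _ _ FL).
have [V [Vc VG]] := continuous_approximation (near1 _ _ _ GL).
have perturb (E E' : normedModType R) (H H' : E -> E') :
    coarse_lipschitz K H -> (forall x, `|H' x - H x| <= 2 * K) ->
    coarse_lipschitz (K * (2 * K + 5)) H'.
  move=> HL HH' x x'.
  have -> : H' x - H' x' = (H' x - H x) + (H x - H x') - (H' x' - H x').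
    by rewrite addrA subrK opprB addrA subrK.
  apply: le_trans (ler_normB _ _) _; apply: le_trans (lerD (ler_normD _ _) (HH' x')) _.
  have := HH' x; have := HL x x'; have := normr_ge0 (x - x').
  move: (`|x - x'|) => t t0.
  have : 0 <= K * t by rewrite mulr_ge0 // ltW.
  have : 0 <= K * (K * t) by rewrite !mulr_ge0 // ltW.
  nra.
have close (E E' : normedModType R) (H H' : E -> E') (J J' : E' -> E) :
    coarse_lipschitz K J -> (forall x, `|H' x - H x| <= 2 * K) ->
    (forall y, `|J' y - J y| <= 2 * K) -> (forall x, `|J (H x) - x| <= K) ->
    forall x, `|J' (H' x) - x| <= K * (2 * K + 5).
  move=> JL HH' JJ' JH x.
  have -> : J' (H' x) - x =
      (J' (H' x) - J (H' x)) + (J (H' x) - J (H x)) + (J (H x) - x).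
    by rewrite !addrA !subrK.
  apply: le_trans (ler_normD _ _) _.
  apply: le_trans (lerD (ler_normD _ _) (JH x)) _.
  have := JJ' (H' x); have := JL (H' x) (H x).
  have := ler_wpM2l (ltW K0) (HH' x).
  nra.
(* The additive error of the perturbed maps is 2K + K + 2K = 5K; a round trip costs 2K + K(2K + 1) +
   K = K(2K + 4). *)
exists U, V, (K * (2 * K + 5)); split=> //.
- by rewrite mulr_gt0 //; lra.
- by split; [exact: perturb FL UF | exact: perturb GL VG].
- exact: close GL UF VG GF.
- exact: close FL VG UF FG.
Qed.

(** * Closed subspaces of finite codimension *)

Section Subspaces.
Variables (R : realType) (X : normedModType R).
Implicit Types (W : set X) (v z : X).

Lemma submod_closedE W : submod_closed [in W] <->
  W 0 /\ forall a u v, W u -> W v -> W (a *: u + v).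
Proof.
split=> [[W0 Wl]|[W0 Wl]].
  split=> [|a u v Wu Wv]; first by rewrite inE in W0.
  by apply/set_mem; apply: Wl; apply/mem_set.
split=> [|a u v Wu Wv]; first exact/mem_set.
by apply/mem_set/Wl; apply/set_mem.
Qed.

Lemma closure_normP W z :
  (forall e : R, 0 < e -> exists2 u, W u & `|z - u| < e) -> closure W z.
Proof.
move=> Wz B /nbhs_normP[e /= e0 eB]; have [u Wu zu] := Wz e e0.
by exists u; split=> //; apply: eB.
Qed.

(** As W is closed, v has distance at least some d > 0 from W, and [L] is 1/d: factor t out of t v +
    u. *)
Lemma line_coefficient_bound W v : submod_closed [in W] -> closed W -> ~ W v ->
  exists2 L : R, 0 < L & forall t u, W u -> `|t| <= L * `|t *: v + u|.
Proof.
move=> /submod_closedE[W0 Wl] Wcl Wv.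
have [d d0 dv] : exists2 d : R, 0 < d & forall u, W u -> d <= `|v - u|.
  apply: contrapT => none; apply: Wv; apply: Wcl; apply: closure_normP => e e0.
  apply: contrapT => far; apply: none; exists e => // u Wu.
  by rewrite leNgt; apply/negP => vu; apply: far; exists u.
exists d^-1; first by rewrite invr_gt0.
move=> t u Wu; have [->|t0] := eqVneq t 0.
  by rewrite normr0 mulr_ge0 // invr_ge0 ltW.
have Wtu : W (- t^-1 *: u) by rewrite -[_ *: _]addr0; exact: Wl.
have -> : t *: v + u = t *: (v - - t^-1 *: u).
  by rewrite scaleNr opprK scalerDr scalerA mulfV // scale1r.
rewrite normrZ mulrCA ler_peMr // -(mulVf (lt0r_neq0 d0)).
by rewrite ler_wpM2l ?invr_ge0 ?(ltW d0) // dv.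
Qed.

Definition add_line W v : set X := [set t *: v + u | t in [set: R] & u in W].

Lemma submod_closed_add_line W v : submod_closed [in W] ->
  submod_closed [in add_line W v].
Proof.
move=> /submod_closedE[W0 Wl]; apply/submod_closedE; split.
  by exists 0 => //; exists 0 => //; rewrite scale0r addr0.
move=> a _ _ [s _ [u Wu <-]] [t _ [w Ww <-]].
exists (a * s + t) => //; exists (a *: u + w); first exact: Wl.
by rewrite scalerDl scalerDr scalerA addrACA.
Qed.

(** If t v + u is within e of z, the coefficient sought lies in [t - L e, t + L e]. These intervals
    meet pairwise, so the supremum [T] of their left ends lies in all of them, and z - T v is a
    limit of points of W. *)
Lemma closed_add_line W v : submod_closed [in W] -> closed W -> ~ W v ->
  closed (add_line W v).
Proof.
move=> Wsub Wcl Wv z zcl.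
have [L L0 Lt] := line_coefficient_bound Wsub Wcl Wv.
have /submod_closedE[W0 Wl] := Wsub.
have near (e : R) : 0 < e -> exists t u, W u /\ `|z - (t *: v + u)| < e.
  move=> e0; have [_ [[t _ [u Wu <-]] tu]] := zcl _ (nbhs_ball_norm z (PosNum e0)).
  by exists t, u.
have cauchy (e e' t t' : R) u u' : W u -> W u' -> `|z - (t *: v + u)| < e ->
    `|z - (t' *: v + u')| < e' -> t - L * e <= t' + L * e'.
  move=> Wu Wu' zu zu'; have Wuu : W (u - u').
    by rewrite -[u]scale1r -scaleN1r addrC; apply: Wl => //; rewrite scale1r.
  have := Lt (t - t') _ Wuu.
  have -> : (t - t') *: v + (u - u') = (z - (t' *: v + u')) - (z - (t *: v + u)).
    by rewrite opprB [RHS]addrC [in RHS]addrA subrK scalerBl opprD addrACA.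
  have := ler_norm (t - t').
  have := ler_wpM2l (ltW L0) (ler_normB (z - (t' *: v + u')) (z - (t *: v + u))).
  have : L * (`|z - (t' *: v + u')| + `|z - (t *: v + u)|) <= L * (e' + e).
    by apply: ler_wpM2l; [exact: ltW | lra].
  lra.
pose S := [set s : R | exists e t u,
  [/\ 0 < e, W u, `|z - (t *: v + u)| < e & s = t - L * e]].
pose T := sup S.
have TE (e t : R) u : 0 < e -> W u -> `|z - (t *: v + u)| < e -> `|T - t| <= L * e.
  move=> e0 Wu zu; rewrite ler_norml lerBrDr lerBlDr [_ + t]addrC; apply/andP; split.
    apply: ub_le_sup; last by exists e, t, u.
    exists (t + L * e) => _ [e' [t' [u' [e'0 Wu' zu' ->]]]].
    exact: cauchy Wu' Wu zu' zu.
  apply: ge_sup; first by exists (t - L * e), e, t, u.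
  move=> _ [e' [t' [u' [e'0 Wu' zu' ->]]]]; rewrite [leRHS]addrC.
  exact: cauchy Wu' Wu zu' zu.
exists T => //; exists (z - T *: v); last by rewrite addrC subrK.
apply: Wcl; apply: closure_normP => e e0.
have Lv0 : 0 < 1 + L * `|v| by rewrite ltr_pwDl // mulr_ge0 // ltW.
pose d := e / (1 + L * `|v|); have d0 : 0 < d by rewrite divr_gt0.
have [t [u [Wu zu]]] := near d d0; exists u => //.
have -> : z - T *: v - u = (z - (t *: v + u)) - (T - t) *: v.
  by rewrite scalerBl opprB opprD !addrA [z - t *: v - u]addrAC subrK addrAC.
apply: le_lt_trans (ler_normB _ _) _; rewrite normrZ.
have := ler_wpM2r (normr_ge0 v) (TE _ _ _ d0 Wu zu).
have : d * (1 + L * `|v|) = e by rewrite /d divfK // gt_eqF.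
lra.
Qed.

(* The estimate makes the coefficients c unique, hence linear and L-Lipschitz in
   x. *)
Lemma finite_codimensional_coordinates W : submod_closed [in W] -> closed W ->
  finite_codimensional W ->
  exists (n : nat) (v : 'I_n -> X) (L : R),
    [/\ 0 < L, forall x, exists c : 'I_n -> R, W (x - \sum_i c i *: v i)
      & forall (c : 'I_n -> R) u i, W u -> `|c i| <= L * `|\sum_i c i *: v i + u|].
Proof.
move=> + + [n [v +]]; elim: n => [|n IH] in W v *.
  move=> Wsub Wcl Wv; exists 0%N, v, 1; split=> // c u []//.
move=> Wsub Wcl Wv; have /submod_closedE[W0 Wl] := Wsub.
(* Induction on the spanning family with W varying: a first vector inside W is dropped, otherwise
   its line is adjoined to W. *)
have [Wv0|Wv0] := pselect (W (v ord0)).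
  apply: (IH W (fun i => v (lift ord0 i))) => // x; have [c Wc] := Wv x.
  exists (fun i => c (lift ord0 i)).
  have := Wl (c ord0) _ _ Wv0 Wc; rewrite big_ord_recl opprD addrCA addNKr; exact.
have [L0 L00 LE0] := line_coefficient_bound Wsub Wcl Wv0.
have [|m [w [L [Lgt0 wspan LE]]]] :=
    IH _ (fun i => v (lift ord0 i)) (submod_closed_add_line (v ord0) Wsub)
      (closed_add_line Wsub Wcl Wv0).
  move=> x; have [c Wc] := Wv x; exists (fun i => c (lift ord0 i)).
  exists (c ord0) => //; eexists; first exact: Wc.
  by rewrite big_ord_recl opprD addrCA addNKr.
pose w' i := if unlift ord0 i is Some j then w j else v ord0.
pose c' t (c : 'I_m -> R) i : R := if unlift ord0 i is Some j then c j else t.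
have sumE (c : 'I_m.+1 -> R) : \sum_i c i *: w' i =
    c ord0 *: v ord0 + \sum_j c (lift ord0 j) *: w j.
  rewrite big_ord_recl /w' unlift_none; congr (_ + _).
  by apply: eq_bigr => j _; rewrite liftK.
pose S := \sum_j `|w j|.
have S0 : 0 <= S by apply: sumr_ge0.
(* The first coefficient is at most L0 times the norm of z minus the other terms, hence at most L0
   (1 + L S) times the norm of z. *)
exists m.+1, w', (L + L0 * (1 + L * S)); split.
- by rewrite ltr_pwDl // mulr_ge0 ?ltW // ltr_pwDl // mulr_ge0 // ltW.
- move=> x; have [c [t _ [u Wu tu]]] := wspan x; exists (c' t c).
  rewrite sumE /c' unlift_none.
  under eq_bigr do rewrite liftK.
  have -> : x - (t *: v ord0 + \sum_j c j *: w j) = u.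
    by rewrite opprD addrCA -tu addKr.
  exact: Wu.
move=> c u i Wu; rewrite sumE addrAC [c ord0 *: _ + u + _]addrC.
set z := (X in _ * `|X|).
have z0 := normr_ge0 z.
have Lj j : `|c (lift ord0 j)| <= L * `|z|.
  rewrite /z; apply: (LE (fun j => c (lift ord0 j)) _ j).
  by exists (c ord0) => //; exists u.
have LS0 : 0 <= L0 * (1 + L * S) by rewrite mulr_ge0 ?addr_ge0 ?mulr_ge0 // ltW.
have L0z : 0 <= L * `|z| by rewrite mulr_ge0 // ltW.
have LSz : 0 <= L0 * (1 + L * S) * `|z| by rewrite mulr_ge0.
case: (unliftP ord0 i) => [j|] ->; first by have := Lj j; lra.
apply: le_trans (LE0 _ _ Wu) _.
have -> : c ord0 *: v ord0 + u = z - \sum_j c (lift ord0 j) *: w j.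
  by rewrite /z addrC addKr.
have : `|z - \sum_j c (lift ord0 j) *: w j| <= `|z| + L * `|z| * S.
  apply: le_trans (ler_normB _ _) _; rewrite lerD2l mulr_sumr.
  apply: le_trans (ler_norm_sum _ _ _) _; apply: ler_sum => j _.
  by rewrite normrZ ler_wpM2r.
move=> /(ler_wpM2l (ltW L00)); lra.
Qed.

End Subspaces.

(** * The Gorelik principle *)

Definition grid_point (R : realType) (X : lmodType R) (n m : nat)
    (v : 'I_n -> X) (w : 'rV['I_(2 * m).+1]_n) : X :=
  \sum_i ((w 0 i)%:R - m%:R) *: v i.

Definition grid_neighbours (N n : nat) (p q : 'rV['I_N.+1]_n) : Prop :=
  forall j, (p 0%R j <= (q 0%R j).+1)%N /\ (q 0%R j <= (p 0%R j).+1)%N.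

Lemma grid_point_neighbours (R : realType) (X : normedModType R) (n m : nat)
    (v : 'I_n -> X) (p q : 'rV['I_(2 * m).+1]_n) :
  grid_neighbours p q ->
  `|grid_point v p - grid_point v q| <= \sum_i `|v i|.
Proof.
move=> pq; rewrite /grid_point -sumrB.
apply: le_trans (ler_norm_sum _ _ _) _; apply: ler_sum => i _.
rewrite -scalerBl opprB addrA subrK normrZ ler_piMl //.
have [] := pq i; rewrite -!(ler_nat R) -!natr1 => h1 h2.
by rewrite ler_norml; lra.
Qed.

Lemma grid_point_norm (R : realType) (X : normedModType R) (n m : nat)
    (v : 'I_n -> X) (w : 'rV['I_(2 * m).+1]_n) :
  `|grid_point v w| <= m%:R * \sum_i `|v i|.
Proof.
rewrite mulr_sumr; apply: le_trans (ler_norm_sum _ _ _) _; apply: ler_sum => i _.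
rewrite normrZ ler_wpM2r //; have := ltn_ord (w 0 i).
rewrite ltnS -(ler_nat R) natrM => h; have := ler0n R (w 0 i).
by rewrite ler_norml; lra.
Qed.

(** Coordinates modulo W are L-Lipschitz, so those of [phi w] differ from those of the grid point by
    less than m and have the right signs on opposite faces. Subtracting the small coordinates found
    in a sign-changing cell gives the point of W. *)
Lemma grid_almost_meets_subspace (R : realType) (X : normedModType R)
    (W : set X) (n m : nat) (v : 'I_n -> X) (L rho E : R)
    (phi : 'rV['I_(2 * m).+1]_n -> X) :
  submod_closed [in W] -> 0 < L ->
  (forall x, exists c : 'I_n -> R, W (x - \sum_i c i *: v i)) ->
  (forall (c : 'I_n -> R) u i, W u -> `|c i| <= L * `|\sum_i c i *: v i + u|) ->
  (forall w, `|phi w - grid_point v w| <= rho) -> L * rho < m%:R ->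
  (forall p q, grid_neighbours p q -> `|phi p - phi q| <= E) ->
  exists w x, W x /\ `|x - phi w| <= 2 * (L * E) * \sum_i `|v i|.
Proof.
move=> /submod_closedE[W0 Wl] L0 /choice[c Wc] cL phig Lrho phiE.
have WB u u' : W u -> W u' -> W (u - u').
  by move=> Wu Wu'; rewrite addrC -scaleN1r; exact: Wl.
have cLip x x' i : `|c x i - c x' i| <= L * `|x - x'|.
  have := cL (fun i => c x i - c x' i) _ i (WB _ _ (Wc x) (Wc x')).
  suff -> : \sum_i (c x i - c x' i) *: v i +
    (x - \sum_i c x i *: v i - (x' - \sum_i c x' i *: v i)) = x - x' by [].
  under eq_bigr do rewrite scalerBl.
  by rewrite sumrB opprB addrACA subrKC addKr.
have cg (w : 'rV['I_(2 * m).+1]_n) i : c (grid_point v w) i = (w 0 i)%:R - m%:R.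
  have := cL (fun i => c (grid_point v w) i - ((w 0 i)%:R - m%:R)) _ i (Wc (grid_point v w)).
  suff -> : \sum_i (c (grid_point v w) i - ((w 0 i)%:R - m%:R)) *: v i +
      (grid_point v w - \sum_i c (grid_point v w) i *: v i) = 0.
    by rewrite normr0 mulr0 normr_le0 subr_eq0 => /eqP.
  under eq_bigr do rewrite scalerBl.
  by rewrite sumrB addrC subrKA; exact: subrr.
have cphi w i : `|c (phi w) i - ((w 0 i)%:R - m%:R)| < m%:R.
  rewrite -cg; apply: le_lt_trans (cLip _ _ _) _; apply: le_lt_trans Lrho.
  exact: ler_wpM2l (ltW L0) _ _ (phig w).
have [|k x xk|w wP] := discrete_poincare_miranda
    (l := fun k w => 0 <= c (phi w) k).
- move=> k x xk; have := cphi x k; rewrite xk ltr_norml sub0r.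
  by move=> h; apply/negbTE; rewrite -ltNge; lra.
- have := cphi x k; rewrite xk ltr_norml natrM /=; lra.
have nbr (p q : 'rV['I_(2 * m).+1]_n) :
    (forall j, (w 0%R j <= p 0%R j <= (w 0%R j).+1)%N) ->
    (forall j, (w 0%R j <= q 0%R j <= (w 0%R j).+1)%N) -> grid_neighbours p q.
  move=> wp wq j; have /andP[p1 p2] := wp j; have /andP[q1 q2] := wq j.
  by split; [apply: leq_trans p2 _ | apply: leq_trans q2 _]; rewrite ltnS.
exists w, (phi w - \sum_i c (phi w) i *: v i); split; first exact: Wc.
rewrite addrAC subrr add0r normrN mulr_sumr.
apply: le_trans (ler_norm_sum _ _ _) _; apply: ler_sum => i _.
rewrite normrZ ler_wpM2r //.
have [p [q [lpq wp wq]]] := wP i.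
have ww j : (w 0%R j <= w 0%R j <= (w 0%R j).+1)%N by rewrite leqnn leqnSn.
have LE p' q' : grid_neighbours p' q' ->
    `|c (phi p') i - c (phi q') i| <= L * E.
  move=> pq; apply: le_trans (cLip _ _ _) _.
  by rewrite ler_wpM2l ?(ltW L0) ?phiE.
(* Opposite signs at p and q bound the coordinate at p by L E; passing from p to w adds another L
   E. *)
have := LE _ _ (nbr _ _ wp wq); have := LE _ _ (nbr _ _ ww wp).
move: lpq; case: (lerP 0 (c (phi p) i)); case: (lerP 0 (c (phi q) i)) => // h1 h2 _;
  rewrite !ler_norml; lra.
Qed.

Theorem theorem3p8 (R : realType) (X Y : completeNormedModType R)
    (X_infdim : ~ finite_dimensional X) (Y_infdim : ~ finite_dimensional Y)
    (X0 : set X) (X0_subspace : submod_closed [in X0]) (X0_closed : closed X0)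
    (X0_fincodim : finite_codimensional X0)
    (XY_net : net_equivalent X Y) :
  exists (U : X -> Y) (V : Y -> X) (K C alpha0 : R),
    [/\ continuous U /\ continuous V,
        [/\ 0 < K, 0 < C & 0 < alpha0],
        (forall x : X, `|V (U x) - x| <= C),
        (forall y : Y, `|U (V y) - y| <= C) &
        forall alpha : R, alpha0 < alpha ->
          exists M : set Y, compact M /\
            scale_set (alpha / (16 * K)) (unit_ball Y) `<=`
            minkowski_sum (minkowski_sum M (scale_set C (unit_ball Y)))
              (U @` scale_set alpha (X0 `&` unit_ball X))].
Proof.
have [U [V [K [UVc K0 [UL VL] VU UV]]]] := net_equivalent_continuous XY_net.
have [n [v [L [L0 X0span cL]]]] :=
  finite_codimensional_coordinates X0_subspace X0_closed X0_fincodim.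
have Kge0 := ltW K0; have Lge0 := ltW L0.
have /submod_closedE[X00 X0l] := X0_subspace.
pose S := \sum_i `|v i|; have S0 : 0 <= S by apply: sumr_ge0.
(* Grid neighbours are at distance at most S; U and then V are applied to them. *)
pose E := K * (K * (S + 1) + 1).
have E0 : 0 <= E by rewrite !(mulr_ge0, addr_ge0).
pose B := 2 * (L * E) * S.
have B0 : 0 <= B by rewrite !(mulr_ge0, addr_ge0).
(* K is the error of U V at U a + y, and K (B + 1) bounds the effect under U of moving phi(a) to
   x. *)
pose C := K + K * (B + 1).
have KC : K <= C by rewrite lerDl mulr_ge0 ?addr_ge0 // ltW.
(* The norm of x is at most B + rho + m S, which is at most D + K' beta = D + alpha/16; the
   threshold 2 D + 1 makes D less than alpha/2. *)
pose D := B + 2 * K + (2 * (L * K) + 1) * S.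
have LK0 : 0 <= L * K by rewrite mulr_ge0.
have D0 : 0 <= D by rewrite !(addr_ge0, mulr_ge0).
pose K' := K * (1 + L * S).
have LS0 : 0 < 1 + L * S by rewrite ltr_pwDl // mulr_ge0.
have K'0 : 0 < K' by rewrite mulr_gt0.
exists U, V, K', C, (2 * D + 1); split=> //.
- by split=> //; [exact: lt_le_trans KC | lra].
- by move=> x; apply: le_trans KC.
- by move=> y; apply: le_trans KC.
move=> alpha alphaD; have alpha0 : 0 < alpha by lra.
pose beta := alpha / (16 * K').
have beta0 : 0 < beta by rewrite divr_gt0 // mulr_gt0.
pose rho := K * (beta + 2).
have rho0 : 0 <= rho by rewrite mulr_ge0 ?ltW // addr_gt0.
(* Above L rho for the signs on the faces, but by at most 1, to keep the grid inside the ball of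
   radius alpha. *)
pose m := (Num.truncn (L * rho)).+1.
have Lrho : L * rho < m%:R by rewrite truncnS_gt.
have mrho : m%:R <= L * rho + 1.
  by rewrite -natr1 lerD2r truncn_le // mulr_ge0.
exists [set - U (grid_point v w) | w in [set: 'rV['I_(2 * m).+1]_n]]; split.
  exact/finite_compact/finite_image/finite_finset.
move=> _ [b /= b1 <-]; set y := _ *: b.
have ybeta : `|y| <= beta.
  by rewrite /y normrZ ger0_norm ?(ltW beta0) // ler_piMr // ltW.
pose phi (w : 'rV['I_(2 * m).+1]_n) := V (U (grid_point v w) + y).
have phig w : `|phi w - grid_point v w| <= rho.
  have -> : phi w - grid_point v w =
      (phi w - V (U (grid_point v w))) + (V (U (grid_point v w)) - grid_point v w).
    by rewrite addrA subrK.
  apply: le_trans (ler_normD _ _) _.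
  have := VL (U (grid_point v w) + y) (U (grid_point v w)).
  have := VU (grid_point v w); rewrite [_ + y - _]addrAC subrr add0r.
  have := ler_wpM2l (ltW K0) ybeta; rewrite /rho /phi; lra.
have phiE p q : grid_neighbours p q -> `|phi p - phi q| <= E.
  move=> /(grid_point_neighbours v) pq; apply: le_trans (VL _ _) _.
  rewrite opprD addrACA subrr addr0 ler_wpM2l ?lerD2r //.
  apply: le_trans (UL _ _) _; by rewrite ler_wpM2l ?lerD2r.
have [w [x [X0x xphi]]] :=
  grid_almost_meets_subspace X0_subspace L0 X0span cL phig Lrho phiE.
rewrite -/S -/B in xphi.
have xalpha : `|x| <= alpha.
  have -> : x = (x - phi w) + (phi w - grid_point v w) + grid_point v w.
    by rewrite addrA !subrK.
  apply: le_trans (ler_normD _ _) _.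
  apply: le_trans (lerD (ler_normD _ _) (grid_point_norm _ _)) _.
  have := phig w; rewrite -/S.
  have := ler_wpM2r S0 mrho.
  have : beta * K' = alpha / 16.
    by rewrite /beta -mulrA invfM -[X in alpha * X]mulrA mulVf ?mulr1 // gt_eqF.
  move: alphaD; rewrite /D /rho /K'; lra.
pose z := U (grid_point v w) + y - U x.
have zC : `|z| <= C.
  have -> : z = (U (phi w) - U x) - (U (phi w) - (U (grid_point v w) + y)).
    by rewrite opprB [RHS]addrC subrKA.
  apply: le_trans (ler_normB _ _) _.
  have := UV (U (grid_point v w) + y); have := UL (phi w) x.
  have := ler_wpM2l (ltW K0) xphi; rewrite distrC /phi /C; lra.
have C0 : 0 < C by apply: lt_le_trans KC.
exists (- U (grid_point v w) + z).
  exists (- U (grid_point v w)); first by exists w.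
  exists z => //; exists (C^-1 *: z); last by rewrite scalerA mulfV ?gt_eqF // scale1r.
  by rewrite /unit_ball /= normrZ ger0_norm ?invr_ge0 ?(ltW C0) // mulrC ler_pdivrMr ?mul1r.
exists (U x); last by rewrite /z -addrA subrK addKr.
exists x => //; exists (alpha^-1 *: x); last by rewrite scalerA mulfV ?gt_eqF // scale1r.
split; first by rewrite -[_ *: _]addr0; exact: X0l.
by rewrite /unit_ball /= normrZ ger0_norm ?invr_ge0 ?(ltW alpha0) // mulrC ler_pdivrMr ?mul1r.
Qed.
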